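(* Let $H=(V,E)$ be a partition-connected hypergraph with $|V|\ge2$, and let $\Gamma(H)$ be its hypertree family. Then $$\operatorname{Mod}_1(\Gamma(H))=S(H).$$
   Context: A hypergraph $H=(V,E)$ has a finite nonempty vertex set $V$ and a finite collection $E$ of subsets of $V$ (hyperedges), where repetitions are allowed (parallel hyperedges are distinct elements of $E$) and every hyperedge has at least two vertices. For a partition $\mathscr P$ of $V$ into nonempty parts, $|\mathscr P|$ is the number of parts and $\delta(\mathscr P)$ is the set of hyperedges intersecting at least two parts. $H$ is partition-connected if $|\delta(\mathscr P)|\ge|\mathscr P|-1$ for every partition $\mathscr P$ of $V$. The strength of $H$ is $S(H)=\min\left\{\frac{|\delta(\mathscr P)|}{|\mathscr P|-1}:\mathscr P\text{ a partition of }V,\ |\mathscr P|\ge2\right\}$. A set $F\subseteq E$ is a hyperforest if for every nonempty $X\subseteq V$ at most $|X|-1$ hyperedges of $F$ are contained in $X$; a hypertree is a hyperforest with $|F|=|V|-1$. The hypertree family $\Gamma(H)$ is the family of all hypertrees of $H$, each identified with its indicator vector in $\mathbb{R}^E_{\ge 0}$. For a family $\Gamma\subset\mathbb{R}^E_{\ge0}$, $\operatorname{Adm}(\Gamma)=\{\rho\in\mathbb{R}^E_{\ge0}:\gamma^T\rho\ge1\ \forall\gamma\in\Gamma\}$ and $\operatorname{Mod}_1(\Gamma)=\inf_{\rho\in\operatorname{Adm}(\Gamma)}\sum_{e\in E}\rho(e)$. *)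

(* Defs.v *)
From HB Require Import structures.
From mathcomp Require Import all_boot all_order all_algebra.

Set Implicit Arguments.
Unset Strict Implicit.
Unset Printing Implicit Defensive.

Import Order.TTheory GRing.Theory Num.Theory.

Local Open Scope nat_scope.

(* Hyperedges are indexed by a finite type, so parallel hyperedges are
   distinct indices with the same value of [hedge]. *)
Record hypergraph := Hypergraph {
  vert : finType;
  edge : finType;
  hedge : edge -> {set vert};
  vert_gt0 : 0 < #|vert|;
  hedge_gt1 : forall e : edge, 1 < #|hedge e|
}.

Definition is_vpartition (H : hypergraph) (P : {set {set vert H}}) : bool :=
  partition P [set: vert H].

Definition crossing (H : hypergraph) (P : {set {set vert H}}) : {set edge H} :=
  [set e : edge H | 2 <= #|[set X in P | X :&: hedge e != set0]|].

Definition partition_connected (H : hypergraph) : Prop :=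
  forall P : {set {set vert H}}, is_vpartition P -> #|P| - 1 <= #|crossing P|.

Definition hyperforest (H : hypergraph) (F : {set edge H}) : bool :=
  [forall X : {set vert H}, (X != set0) ==>
    (#|[set e in F | hedge e \subset X]| <= #|X| - 1)].

Definition hypertree (H : hypergraph) (F : {set edge H}) : bool :=
  hyperforest F && (#|F| == #|vert H| - 1).

(* Imported only here because classical_sets shadows [partition] and [set0]
   of finset. *)
From mathcomp Require Import boolp classical_sets reals constructive_ereal ereal.

Local Open Scope classical_set_scope.
Local Open Scope ring_scope.

(* The minimum over the (finite) set of partitions is taken in the extended
   reals, with value +oo when there is no partition with at least two parts,
   i.e. when there is only one vertex. *)
Definition strength (R : realType) (H : hypergraph) : \bar R :=
  \big[Order.min/+oo%E]_(P : {set {set vert H}} |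
      is_vpartition P && (2 <= #|P|)%N)
    (#|crossing P|%:R / (#|P|%:R - 1))%:E.

Definition indicator (R : realType) (E : finType) (F : {set E}) :
  {ffun E -> R} := [ffun e => (e \in F)%:R].

Definition hypertree_family (R : realType) (H : hypergraph) :
  set {ffun edge H -> R} :=
  [set gamma : {ffun edge H -> R} |
     exists2 F : {set edge H}, hypertree F & indicator R F = gamma].
Arguments hypertree_family R H : clear implicits.

Definition Adm (R : realType) (E : finType) (Gamma : set {ffun E -> R}) :
  set {ffun E -> R} :=
  [set rho : {ffun E -> R} | (forall e : E, 0 <= rho e) /\
     (forall gamma : {ffun E -> R}, Gamma gamma ->
        1 <= \sum_(e : E) gamma e * rho e)].

Definition Mod1 (R : realType) (E : finType) (Gamma : set {ffun E -> R}) :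
  \bar R :=
  ereal_inf [set (\sum_(e : E) rho e)%:E | rho in Adm Gamma].

(* Main.v *)
(** The normalised indicator of [crossing P] is admissible for every partition
    [P], because a hypertree has at most [#|X| - 1] hyperedges inside each part
    [X]; hence [Mod1 <= strength].  For the converse, the subsets [X] tight for
    a hyperforest [F] are closed under intersecting unions, so the maximal ones
    partition the vertices; if [F] is a maximal hyperforest inside a set [A] of
    hyperedges, no hyperedge of [A] outside [F] crosses this partition, which
    computes [#|F|] exactly.  Consequently
    [strength * (#|V| - 1 - #|F|) <= #|E| - #|A|], and adding up these
    inequalities over the prefixes of [E] sorted by weight shows that the greedy
    hypertree [T] satisfies [strength * w(T) <= w(E)] for every weight
    [w >= 0]. *)
Require Import Defs.
From HB Require Import structures.
From mathcomp Require Import all_boot all_order all_algebra.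
From mathcomp Require Import zify lra.

Set Implicit Arguments.
Unset Strict Implicit.
Unset Printing Implicit Defensive.

Import Order.TTheory GRing.Theory Num.Theory.

Local Open Scope nat_scope.

(** * Tight sets of a hyperforest *)

Section Hyperforests.
Variable H : hypergraph.
Implicit Types (A F : {set edge H}) (P : {set {set vert H}}).
Implicit Types (X Y : {set vert H}) (x y : vert H) (e : edge H).

Definition edges_within F X : {set edge H} := [set e in F | hedge e \subset X].

Lemma hyperforestP F :
  reflect (forall X, X != set0 -> #|edges_within F X| < #|X|) (hyperforest F).
Proof.
apply: (iffP forallP) => [hF X X0 | hF X].
  have := implyP (hF X) X0; have : 0 < #|X| by rewrite card_gt0.
  rewrite /edges_within; lia.
by apply/implyP => X0; have := hF X X0; rewrite /edges_within; lia.
Qed.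

Lemma hyperforest0 : hyperforest (set0 : {set edge H}).
Proof.
apply/hyperforestP => X X0; rewrite [edges_within _ _](_ : _ = set0).
  by rewrite cards0 card_gt0.
by apply/setP => e; rewrite !inE.
Qed.

Lemma hedge_neq0 e : hedge e != set0.
Proof. by rewrite -card_gt0; have := hedge_gt1 e; lia. Qed.

(** The equality case of the bound in [hyperforestP]. *)
Definition tight F X := #|edges_within F X|.+1 == #|X|.

Lemma tight1 F x : tight F [set x].
Proof.
rewrite /tight cards1 eqSS cards_eq0; apply/eqP/setP => e; rewrite !inE.
apply/negbTE/negP => /andP[_ /subset_leq_card]; rewrite cards1.
by have := hedge_gt1 e; lia.
Qed.

(* Uncrossing: [X |-> #|edges_within F X|] is supermodular, while [#|X|] is
   modular. *)
Lemma tightU F X Y : hyperforest F -> X :&: Y != set0 ->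
  tight F X -> tight F Y -> tight F (X :|: Y).
Proof.
move=> /hyperforestP hF XY0 /eqP tX /eqP tY.
have hI := hF _ XY0.
have hU : #|edges_within F (X :|: Y)| < #|X :|: Y|.
  apply: hF; apply: contraNneq XY0 => XY; rewrite -subset0 -XY.
  exact: subset_trans (subsetIl _ _) (subsetUl _ _).
have sub : edges_within F X :|: edges_within F Y \subset edges_within F (X :|: Y).
  apply/subsetP => e; rewrite !inE -andb_orr => /andP[-> /=].
  by move=> /orP[] h; apply: subset_trans h _; rewrite ?subsetUl ?subsetUr.
have eI : edges_within F X :&: edges_within F Y = edges_within F (X :&: Y).
  by apply/setP => e; rewrite !inE subsetI; case: (e \in F).
have := subset_leq_card sub; have := cardsUI (edges_within F X) (edges_within F Y).
have := cardsUI X Y.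
by rewrite eI /tight; lia.
Qed.

(** For a hyperforest [F] this is the largest tight set through [x]: all the sets in the union share
    [x], so [tightU] merges them. *)
Definition tight_hull F x : {set vert H} :=
  \bigcup_(X : {set vert H} | tight F X && (x \in X)) X.

Lemma mem_tight_hull F x : x \in tight_hull F x.
Proof.
by apply/bigcupP; exists [set x]; rewrite ?tight1 ?set11.
Qed.

Lemma sub_tight_hull F x X : tight F X -> x \in X -> X \subset tight_hull F x.
Proof. by move=> tX xX; apply: bigcup_sup; rewrite tX. Qed.

Lemma tight_tight_hull F x : hyperforest F -> tight F (tight_hull F x).
Proof.
(* Adjoining [x] makes the empty union tight and lets any two sets of the induction meet, as
   [tightU] requires. *)
move=> hF; suff : tight F (x |: tight_hull F x).
  by rewrite (setUidPr _) // sub1set mem_tight_hull.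
apply: (big_ind (fun X => tight F (x |: X))) => [|X Y tX tY|X /andP[tX xX]].
- by rewrite setU0 tight1.
- rewrite -[[set x]]setUid setUACA tightU //.
  by apply/set0Pn; exists x; rewrite !inE eqxx.
- by rewrite (setUidPr _) // sub1set.
Qed.

(** By maximality the hull of [y] contains that of [x], hence [x] itself, and the argument reverses.
    So hulls are equal or disjoint. *)
Lemma tight_hull_eq F x y : hyperforest F ->
  y \in tight_hull F x -> tight_hull F y = tight_hull F x.
Proof.
move=> hF yx.
have sxy : tight_hull F x \subset tight_hull F y.
  by apply: sub_tight_hull => //; apply: tight_tight_hull.
apply/eqP; rewrite eqEsubset sxy andbT.
apply: sub_tight_hull; first exact: tight_tight_hull.
exact: subsetP sxy _ (mem_tight_hull F x).
Qed.

Definition tight_partition F : {set {set vert H}} :=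
  [set tight_hull F x | x : vert H].

Lemma tight_partitionP F : hyperforest F -> is_vpartition (tight_partition F).
Proof.
move=> hF; apply/and3P; split.
- rewrite eqEsubset subsetT /=; apply/subsetP => x _.
  apply/bigcupP; exists (tight_hull F x); last exact: mem_tight_hull.
  exact: imset_f.
- apply/trivIsetP => _ _ /imsetP[x _ ->] /imsetP[y _ ->]; apply: contraNT.
  move=> /pred0Pn[z /= /andP[zx zy]].
  by rewrite -(tight_hull_eq hF zx) -(tight_hull_eq hF zy).
- apply/imsetP => -[x _ /esym x0].
  by have := mem_tight_hull F x; rewrite x0 inE.
Qed.

(** * Counting hyperedges along a partition *)

Lemma card_within_crossing P e : is_vpartition P ->
  #|[set X in P | hedge e \subset X]| + (e \in crossing P) = 1.
Proof.
move=> /and3P[/eqP cP tP _]; rewrite inE.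
set B := [set X in P | X :&: hedge e != set0]; set C := [set X in P | _].
have block y : y \in hedge e -> (pblock P y \in B) && (y \in pblock P y).
  move=> ye; have yP : y \in cover P by rewrite cP.
  rewrite inE pblock_mem //= mem_pblock yP andbT.
  by apply/set0Pn; exists y; rewrite inE mem_pblock yP.
have /set0Pn[x xe] := hedge_neq0 e.
have B_gt0 : 0 < #|B|.
  by rewrite card_gt0; apply/set0Pn; exists (pblock P x); case/andP: (block x xe).
(* [B] collects the parts meeting [e]. If there are several, no part contains [e]; if there is only
   one, it contains [e]. *)
have [B2 | B2] := ltnP 1 #|B|.
  suff -> : C = set0 by rewrite cards0.
  apply/setP => X; rewrite [RHS]inE; apply/negbTE/negP.
  rewrite inE => /andP[XP eX]; suff : B \subset [set X].
    by move=> /subset_leq_card; rewrite cards1 leqNgt B2.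
  apply/subsetP => Y; rewrite !inE => /andP[YP /set0Pn[y]].
  rewrite inE => /andP[yY ye].
  by rewrite -(def_pblock tP YP yY) (def_pblock tP XP) // (subsetP eX).
have /cards1P[X BX] : #|B| == 1 by lia.
suff -> : C = [set X] by rewrite cards1.
have XB : X \in B by rewrite BX set11.
apply/setP => Y; rewrite [in RHS]inE; apply/idP/eqP => [|->].
  rewrite inE => /andP[YP eY]; apply/set1P; rewrite -BX inE YP.
  by apply/set0Pn; exists x; rewrite inE xe (subsetP eY).
rewrite inE; have := XB; rewrite inE => /andP[-> _] /=.
apply/subsetP => y /block /andP[].
by rewrite BX => /set1P ->.
Qed.

(** Double counting: [card_within_crossing] summed over [F]. *)
Lemma card_edges_partition P F : is_vpartition P ->
  #|F| = \sum_(X in P) #|edges_within F X| + #|F :&: crossing P|.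
Proof.
move=> hP.
have -> : \sum_(X in P) #|edges_within F X|
    = \sum_(e in F) #|[set X in P | hedge e \subset X]|.
  transitivity (\sum_(X in P) \sum_(e in F | hedge e \subset X) 1).
    by apply: eq_bigr => X _; rewrite sum1_card; apply: eq_card => e; rewrite !inE.
  rewrite (exchange_big_dep (mem F)) /=; last by move=> X e _ /andP[].
  apply: eq_bigr => e eF; rewrite sum1_card.
  by apply: eq_card => X; rewrite !inE /= -topredE /= eF.
have -> : #|F :&: crossing P| = \sum_(e in F) (e \in crossing P).
  rewrite -sum1_card; under eq_bigl do rewrite inE.
  by rewrite big_mkcondr; apply: eq_bigr => e _; case: (e \in _).
rewrite -big_split /= -sum1_card; apply: eq_bigr => e _.
by rewrite card_within_crossing.
Qed.

Lemma card_vert_partition P : is_vpartition P -> #|vert H| = \sum_(X in P) #|X|.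
Proof. by rewrite -cardsT => /card_partition. Qed.

(** Each part [X] holds at most [#|X| - 1] hyperedges of [F]. For a hypertree this yields at least
    [#|P| - 1] crossing hyperedges. *)
Lemma hyperforest_card_le P F : is_vpartition P -> hyperforest F ->
  #|F| + #|P| <= #|vert H| + #|F :&: crossing P|.
Proof.
move=> hP /hyperforestP hF.
rewrite (card_edges_partition F hP) (card_vert_partition hP).
rewrite addnAC leq_add2r -sum1_card -big_split /=.
apply: leq_sum => X XP; rewrite addn1 hF //.
by case/and3P: hP => _ _; apply: contraNneq => <-.
Qed.

(** * Maximal hyperforests and their size *)

Definition max_hyperforest A F :=
  [&& F \subset A, hyperforest F &
      [forall e in A, (e \notin F) ==> ~~ hyperforest (e |: F)]].

(** A set violating the bound for [e |: F] satisfies it for [F]. Hence it contains [e], and a single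
    extra hyperedge breaks the bound only if the set was tight. *)
Lemma blocked_edge F e : hyperforest F -> ~~ hyperforest (e |: F) ->
  exists2 X, tight F X & hedge e \subset X.
Proof.
move=> /hyperforestP hF /hyperforestP heF.
have /existsP[X /andP[X0 hX]] :
    [exists X, (X != set0) && (#|X| <= #|edges_within (e |: F) X|)].
  apply: contra_notT heF => /existsPn hX X X0.
  by have := hX X; rewrite X0 /= -ltnNge.
have sub : edges_within (e |: F) X \subset e |: edges_within F X.
  by apply/subsetP => f; rewrite !inE => /andP[/orP[->//|->] ->]; rewrite orbT.
have := hF X X0; have := subset_leq_card sub; rewrite cardsU1 => h1 h2.
exists X; first by rewrite /tight; lia.
apply: contraLR hX => eX; rewrite -ltnNge; apply: leq_ltn_trans h2.
apply/subset_leq_card/subsetP => f; rewrite !inE => /andP[/orP[/eqP->|->->//]].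
by rewrite (negbTE eX).
Qed.

(** The rank formula of the hypergraphic matroid, with [F] a basis of [A]. Tight parts give equality
    in [hyperforest_card_le], and hyperedges of [A] outside [F] lie within a part by
    [blocked_edge]. *)
Lemma max_hyperforest_card A F : max_hyperforest A F ->
  exists2 P, is_vpartition P &
    #|F| + #|P| = #|vert H| + #|A :&: crossing P|.
Proof.
move=> /and3P[FA hF /forall_inP hmax].
have hP := tight_partitionP hF.
exists (tight_partition F) => //; set P := tight_partition F in hP *.
have -> : A :&: crossing P = F :&: crossing P.
  apply/setP => e; rewrite !in_setI; apply/andP/andP => -[eA eP]; split=> //.
    apply: contraLR eP => eF.
    have [X tX eX] := blocked_edge hF (implyP (hmax e eA) eF).
    have /set0Pn[x xe] := hedge_neq0 e.
    have := card_within_crossing e hP; case: (e \in _) => //.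
    suff : 0 < #|[set Y in P | hedge e \subset Y]| by lia.
    rewrite card_gt0; apply/set0Pn; exists (tight_hull F x).
    rewrite inE imset_f //=; apply: (subset_trans eX).
    by apply: sub_tight_hull => //; apply: (subsetP eX).
  exact: subsetP FA _ eA.
rewrite (card_edges_partition F hP) (card_vert_partition hP).
rewrite addnAC -sum1_card -big_split /=; congr (_ + _).
apply: eq_bigr => _ /imsetP[x _ ->]; rewrite addn1.
exact/eqP/tight_tight_hull.
Qed.

(** Partition-connectedness turns the rank formula for [setT] into [#|F| >= #|V| - 1]; the
    hyperforest bound on the whole vertex set gives the converse. *)
Lemma max_hyperforest_hypertree F :
  partition_connected H -> max_hyperforest setT F -> hypertree F.
Proof.
move=> Hc Fmax; have [P hP] := max_hyperforest_card Fmax.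
have [_ hF _] := and3P Fmax; rewrite /hypertree hF setTI => cF.
have := Hc P hP; have V0 := vert_gt0 H.
have : #|F| < #|vert H|.
  rewrite -cardsT; apply: leq_ltn_trans (hyperforestP _ hF _ _).
    by apply/subset_leq_card/subsetP => e eF; rewrite inE eF subsetT.
  by rewrite -card_gt0 cardsT.
by lia.
Qed.

(** * The greedy algorithm *)

Lemma greedy_hyperforest (s : seq (edge H)) : uniq s ->
  exists T : {set edge H}, forall s1 s2, s = s1 ++ s2 ->
    max_hyperforest [set e in s1] (T :&: [set e in s1]).
Proof.
elim/last_ind: s => [|s e IH].
  move=> _; exists set0 => -[|//] s2 _.
  rewrite set0I /max_hyperforest sub0set hyperforest0 /=.
  by apply/forall_inP => e; rewrite inE.
rewrite rcons_uniq => /andP[es us]; have [T hT] := IH us.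
have /and3P[_ hF /forall_inP hmax] := hT s [::] (esym (cats0 s)).
set F := T :&: [set e in s] in hF hmax.
(* The last hyperedge [e] is accepted exactly when the hyperforest property survives. Since [e] is
   absent from [s], the traces on prefixes of [s] do not change. *)
exists (if hyperforest (e |: F) then e |: F else F) => s1 s2.
have FI s1' s2' : s = s1' ++ s2' -> e \notin s1' /\
    F :&: [set e in s1'] = T :&: [set e in s1'].
  move=> ss; split; first by apply: contra es; rewrite ss mem_cat => ->.
  rewrite /F -setIA; congr (_ :&: _); apply/setIidPr/subsetP => f.
  by rewrite !inE ss mem_cat => ->.
case/lastP: s2 => [|s2 e'] ss; last first.
  move: ss; rewrite -rcons_cat => /rcons_inj[ss _].
  have [es1 FI1] := FI _ _ ss.
  suff -> : (if hyperforest (e |: F) then e |: F else F) :&: [set e in s1]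
            = T :&: [set e in s1] by exact: hT ss.
  case: ifP => _ //; rewrite setIUl FI1 (_ : [set e] :&: _ = set0) ?set0U //.
  by apply/setP => f; rewrite !inE; case: eqP => // ->; rewrite (negbTE es1).
rewrite cats0 in ss; rewrite -ss.
have Fs : F \subset [set f in rcons s e].
  by apply/subsetP => f; rewrite !inE mem_rcons inE => /andP[_ ->]; rewrite orbT.
rewrite (setIidPl _); last first.
  case: ifP => // _; rewrite subUset Fs andbT sub1set.
  by rewrite inE mem_rcons mem_head.
case: ifP => heF; apply/and3P; split => //.
- by rewrite subUset Fs andbT sub1set inE mem_rcons mem_head.
- apply/forall_inP => f; rewrite inE mem_rcons inE in_setU1 negb_or.
  case/orP => [/eqP->|fs]; first by rewrite eqxx.
  apply/implyP => /andP[fe fF].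
  (* A hyperedge rejected earlier stays rejected, because subsets of hyperforests are
     hyperforests. *)
  have := implyP (hmax f _) fF; rewrite inE fs => /(_ isT).
  apply: contra => /hyperforestP h; apply/hyperforestP => X X0.
  apply: leq_ltn_trans (h X X0).
  apply/subset_leq_card/subsetP => g; rewrite !inE => /andP[/orP[->|->] ->] //.
  by rewrite !orbT.
- apply/forall_inP => f; rewrite inE mem_rcons inE.
  case/orP => [/eqP->|fs]; first by rewrite heF implybT.
  by apply: hmax; rewrite inE.
Qed.

End Hyperforests.

Local Open Scope ring_scope.

(* Abel summation: only the tail sums of [f] have to be nonnegative. *)
Lemma sum_mul_sorted_ge (R : realDomainType) (I : Type) (f w : I -> R)
    (s : seq I) (c : R) :
  path <=%R c [seq w i | i <- s] ->
  (forall s1 s2, s = s1 ++ s2 -> 0 <= \sum_(i <- s2) f i) ->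
  c * \sum_(i <- s) f i <= \sum_(i <- s) f i * w i.
Proof.
elim: s c => [|i s IH] c /=; first by rewrite !big_nil mulr0.
move=> /andP[ci ws] fs; have f_ge0 := fs [::] _ erefl.
apply: le_trans (ler_wpM2r f_ge0 ci) _.
rewrite !big_cons mulrDr mulrC lerD2l; apply: IH => // s1 s2 ss.
by apply: (fs (i :: s1)); rewrite ss.
Qed.

Lemma singletons_vpartition (H : hypergraph) :
  is_vpartition [set [set x] | x : vert H].
Proof.
apply/and3P; split.
- rewrite eqEsubset subsetT /=; apply/subsetP => x _.
  by apply/bigcupP; exists [set x]; rewrite ?set11 ?imset_f.
- apply/trivIsetP => _ _ /imsetP[x _ ->] /imsetP[y _ ->].
  by apply: contraNT => /pred0Pn[z /= /andP[/set1P <- /set1P <-]].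
- by apply/imsetP => -[x _ /setP/(_ x)]; rewrite !inE eqxx.
Qed.

Lemma vpartition_gt0 (H : hypergraph) (P : {set {set vert H}}) :
  is_vpartition P -> (0 < #|P|)%N.
Proof.
move=> hP; rewrite card_gt0; apply: contraTneq (vert_gt0 H) => P0.
by rewrite (card_vert_partition hP) P0 big_set0.
Qed.

(** * The weighted bound for the greedy hypertree *)

Section GreedyBound.
Variables (R : realFieldType) (H : hypergraph) (s : R).
Hypothesis s_ge1 : 1 <= s.
Hypothesis s_le_crossing : forall P : {set {set vert H}},
  is_vpartition P -> s * (#|P|%:R - 1) <= #|crossing P|%:R.

(** For the partition [P] of the rank formula the deficiency is [#|P| - 1 - #|A :&: crossing P|].
    The subtracted term, multiplied by [s >= 1], absorbs the crossing hyperedges in [A]; the others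
    lie in [~: A]. *)
Lemma rank_deficiency_le (A F : {set edge H}) : max_hyperforest A F ->
  s * (#|vert H|%:R - 1 - #|F|%:R) <= #|~: A|%:R.
Proof.
move=> /max_hyperforest_card[P hP cF].
have -> : #|vert H|%:R - 1 - #|F|%:R = #|P|%:R - 1 - #|A :&: crossing P|%:R :> R.
  by have := congr1 (fun n : nat => n%:R : R) cF; rewrite !natrD; lra.
have le_compl : (#|crossing P| <= #|~: A| + #|A :&: crossing P|)%N.
  rewrite -(cardsID A (crossing P)) setIC addnC leq_add2r subset_leq_card //.
  by apply/subsetP => e; rewrite !inE => /andP[].
have := s_le_crossing hP; move: le_compl; rewrite -(ler_nat R) natrD.
have : 0 <= #|A :&: crossing P|%:R :> R by [].
by have := s_ge1; nra.
Qed.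

Lemma light_hypertree (w : edge H -> R) : partition_connected H ->
  (forall e, 0 <= w e) ->
  exists2 T : {set edge H}, hypertree T &
    s * \sum_(e in T) w e <= \sum_e w e.
Proof.
move=> Hc w_ge0; pose r := sort (relpre w <=%R) (enum (edge H)).
have ru : uniq r by rewrite sort_uniq enum_uniq.
have mem_r e : e \in r by rewrite mem_sort mem_enum.
have [T hT] := greedy_hyperforest ru.
have tT : hypertree T.
  apply: max_hyperforest_hypertree Hc _.
  have := hT r [::] (esym (cats0 r)).
  rewrite (_ : [set e in r] = setT) ?setIT //.
  by apply/setP => e; rewrite !inE mem_r.
exists T => //.
(* With these coefficients [\sum_e f e * w e] is the difference of the two sides of the goal. Abel
   summation applies with [c = 0], a lower bound for the weights. *)
pose f e : R := 1 - s * (e \in T)%:R.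
suff : 0 * \sum_(e <- r) f e <= \sum_(e <- r) f e * w e.
  rewrite mul0r (perm_big (enum (edge H))) ?perm_sort //= big_enum /=.
  under eq_bigr do rewrite mulrBl mul1r -mulrA.
  rewrite sumrB -mulr_sumr subr_ge0 => h; apply: le_trans h.
  rewrite le_eqVlt [X in _ * X == _]big_mkcond; apply/orP; left; apply/eqP.
  by congr (_ * _); apply: eq_bigr => e _; case: (e \in T); rewrite ?mul1r ?mul0r.
apply: sum_mul_sorted_ge => [|r1 r2 rE].
  rewrite path_sortedE; last exact: le_trans.
  rewrite sorted_map sort_sorted ?andbT; last by move=> x y; apply: le_total.
  by apply/allP => _ /mapP[e _ ->].
(* The tail [r2] enumerates [~: A], so its [f]-sum is [#|~: A| - s * #|T :\: A|], where [#|T :\: A|]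
   is the rank deficiency of the prefix [A]. *)
have := hT _ _ rE; set A := [set e in r1] => /rank_deficiency_le.
have mem_r2 e : (e \in r2) = (e \in ~: A).
  have := mem_r e; move: ru; rewrite rE cat_uniq => /and3P[_ /hasPn h _].
  rewrite mem_cat !inE; case: (boolP (e \in r2)) => [/h/negbTE /= -> //|_].
  by rewrite orbF => ->.
have r2u : uniq r2 by move: ru; rewrite rE cat_uniq => /and3P[].
rewrite big_uniq //= (eq_bigl _ _ mem_r2) sumrB -mulr_sumr sumr_const.
have -> : \sum_(e in ~: A) (e \in T)%:R = #|T :\: A|%:R :> R.
  rewrite -natr_sum -big_mkcondr sum1_card; congr _%:R; apply: eq_card => e.
  by rewrite unfold_in /= in_setC in_setD.
have /andP[_ /eqP cT] := tT.
have -> : #|vert H|%:R - 1 = #|T|%:R :> R by rewrite cT natrB ?vert_gt0.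
by rewrite -(cardsID A T) natrD addrAC subrr add0r subr_ge0.
Qed.

End GreedyBound.

(* Only now, since classical_sets shadows [set0], [partition] and the set
   notations of finset. *)
From mathcomp Require Import boolp classical_sets reals constructive_ereal ereal.

(** * Modulus equals strength *)

Theorem theorem1p7 (R : realType) (H : hypergraph)
    (H_conn : partition_connected H) (H_gt1 : (2 <= #|vert H|)%N) :
  Mod1 (hypertree_family R H) = strength R H.
Proof.
have card1_gt0 (P : {set {set vert H}}) : (2 <= #|P|)%N -> 0 < #|P|%:R - 1 :> R.
  by rewrite subr_gt0 ltr1n.
have strength_le : forall P : {set {set vert H}}, is_vpartition P ->
    (2 <= #|P|)%N ->
    (strength R H <= (#|crossing P|%:R / (#|P|%:R - 1))%:E)%E.
  by move=> P hP P2; apply: Order.TotalTheory.bigmin_le_cond; rewrite hP.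
apply/eqP; rewrite eq_le; apply/andP; split.
  apply: Order.POrderTheory.le_bigmin => [|P /andP[hP P2]]; first exact: leey.
  apply: ereal_inf_lbound.
  (* This density has total mass equal to the ratio of [P]. *)
  exists [ffun e => (e \in crossing P)%:R / (#|P|%:R - 1)]; last first.
    congr _%:E; under eq_bigr do rewrite ffunE.
    rewrite -mulr_suml -natr_sum; congr (_%:R / _).
    by rewrite -big_mkcond sum1_card.
  split=> [e|_ [T /andP[hT /eqP cT] <-]].
    by rewrite ffunE divr_ge0 // ltW // card1_gt0.
  under eq_bigr do rewrite !ffunE mulrA -natrM mulnb.
  rewrite -mulr_suml -natr_sum ler_pdivlMr ?card1_gt0 // mul1r.
  rewrite -big_mkcond sum1_card.
  have := hyperforest_card_le hP hT; rewrite cT.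
  rewrite (eq_card (B := T :&: crossing P)); last by move=> e; rewrite unfold_in finset.in_setI.
  move=> h; rewrite lerBlDr natr1 ler_nat; move: h.
  by have := vert_gt0 H; lia.
(* Partition-connectedness says exactly that every ratio is at least 1. *)
have strength_ge1 : (1%:E <= strength R H)%E.
  apply: Order.POrderTheory.le_bigmin => [|P /andP[hP P2]]; first exact: leey.
  rewrite lee_fin ler_pdivlMr ?card1_gt0 // mul1r.
  by rewrite lerBlDr natr1 ler_nat; have := H_conn P hP; lia.
(* The partition into singletons, which has at least two parts, rules out [+oo]. *)
have [s strengthE] : exists s, strength R H = s%:E.
  have := strength_le _ (singletons_vpartition H).
  rewrite card_imset ?cardsT; last exact: set1_inj.
  move=> /(_ H_gt1); case: (strength R H) strength_ge1 => [s _ _| |] //.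
  by exists s.
rewrite strengthE in strength_ge1 strength_le *.
apply/ereal_infP => _ [rho [rho_ge0 rho_adm] <-]; rewrite lee_fin.
rewrite lee_fin in strength_ge1.
have s_le_crossing (P : {set {set vert H}}) : is_vpartition P ->
    s * (#|P|%:R - 1) <= #|crossing P|%:R.
  (* A one-part partition does not enter the strength, but there the left side is 0. *)
  move=> hP; have [P2|P1] := leqP 2 #|P|.
    by have := strength_le P hP P2; rewrite lee_fin ler_pdivlMr ?card1_gt0.
  have -> : #|P| = 1%N by have := vpartition_gt0 hP; lia.
  by rewrite subrr mulr0.
(* Taking [rho] as the weight, admissibility gives [rho(T) >= 1], so [s <= s * rho(T) <= rho(E)]. *)
have [T hT] := light_hypertree strength_ge1 s_le_crossing H_conn rho_ge0.
apply: le_trans; rewrite ler_peMr ?(le_trans ler01) //.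
have := rho_adm _ (ex_intro2 _ _ T hT erefl).
rewrite [X in _ -> _ <= X]big_mkcond /=.
under eq_bigr do rewrite ffunE mulr_natl mulrb.
by [].
Qed.
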